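(* Let $k$ be a field and let $(\Omega^1(A),d)$ be a left covariant first order differential calculus on a Hopf algebra $A$ over $k$ with coproduct $\Delta$, counit $\varepsilon$ and bijective antipode $S$. (1) Let $\{\omega_1,\dots,\omega_n\}$ be a left invariant basis for $\Omega^1(A)$, let $\{\xi_1,\dots,\xi_n\}$ be its right dual basis and let $\{\lambda_1,\dots,\lambda_n\}$ be its left dual basis. Then $$\nabla:\mathrm{Hom}_A(\Omega^1(A),A)\to A,\qquad f\mapsto\sum_i\left(S^2\circ\lambda_i\circ d\circ S^{-2}\right)(f(\omega_i))=\sum_i(\chi_i\circ S^{-2})\triangleright f(\omega_i),$$ where $\chi_i=\varepsilon\circ\lambda_i\circ d:A\to k$, is the unique hom-connection on $A$ such that $\nabla(\xi_i)=0$ for all $i=1,\dots,n$. (2) Assume that $\Omega^1(A)$ extends to a differential graded algebra over $A$ such that the hom-connection $\nabla$ of item (1) is flat, and that there is a right integral $\lambda:A\to k$ on the Hopf algebra $A$. Then there exists a unique $k$-linear map $\varphi:\mathrm{coker}(\nabla)\to k$ such that $\lambda=\varphi\circ\Lambda$, where $\Lambda:A\to\mathrm{coker}(\nabla)$ is the $\nabla$-integral on $A$.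
   Context: Sweedler notation: $\Delta(a)=a_{(1)}\otimes a_{(2)}$. A first order differential calculus on $A$ is an $A$-bimodule $\Omega^1(A)$ with a $k$-linear map $d:A\to\Omega^1(A)$ satisfying the Leibniz rule; here $\Omega^1(A)$ is spanned by elements $a\,d(b)$. It is left covariant if $\Delta$ extends to a well-defined map $\Delta_L:\Omega^1(A)\to A\otimes\Omega^1(A)$, $\Delta_L(a\,d(b))=a_{(1)}b_{(1)}\otimes a_{(2)}d(b_{(2)})$. A left invariant basis is a finite family $\omega_1,\dots,\omega_n\in\Omega^1(A)$ with $\Delta_L(\omega_i)=1\otimes\omega_i$ that freely generates $\Omega^1(A)$ as an $A$-module (by Woronowicz, both as a left and as a right module); it is assumed that such a finite basis exists. The right dual basis consists of the right $A$-module maps $\xi_i:\Omega^1(A)\to A$ with $\xi_i(\omega_j)=\delta_{ij}$; the left dual basis consists of the left $A$-module maps $\lambda_i:\Omega^1(A)\to A$ with $\lambda_i(\omega_j)=\delta_{ij}$. For a linear functional $g:A\to k$ and $a\in A$, $g\triangleright a=a_{(1)}g(a_{(2)})$. A hom-connection on $A$ is a $k$-linear map $\nabla:\mathrm{Hom}_A(\Omega^1(A),A)\to A$ ($\mathrm{Hom}_A$ = right $A$-module maps) such that $\nabla(fa)=\nabla(f)a+f(da)$, where $(fa)(\omega)=f(a\omega)$. A differential graded algebra over $A$ is a non-negatively graded differential graded algebra $(\Omega(A),d)$ with $\Omega^0(A)=A$. For $f\in\mathrm{Hom}_A(\Omega^{n+m}(A),A)$, $\omega\in\Omega^n(A)$,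 define $f\omega\in\mathrm{Hom}_A(\Omega^m(A),A)$ by $(f\omega)(\omega')=f(\omega\omega')$. For $n>0$ let $\nabla_n:\mathrm{Hom}_A(\Omega^{n+1}(A),A)\to\mathrm{Hom}_A(\Omega^n(A),A)$, $\nabla_n(f)(\omega)=\nabla(f\omega)+(-1)^{n+1}f(d\omega)$. The hom-connection is flat if $\nabla\circ\nabla_1=0$. The $\nabla$-integral on $A$ is the canonical map $\Lambda:A\to\mathrm{coker}(\nabla)$. A right integral on $A$ is a $k$-linear map $\lambda:A\to k$ with $\lambda(a_{(1)})a_{(2)}=\lambda(a)1$ for all $a\in A$. *)

(* Defs.v *)
From HB Require Import structures.
From mathcomp Require Import all_boot all_order all_algebra.
From mathcomp Require Import ring_quotient.
From mathcomp Require Import boolp classical_sets functions.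
From mathcomp.multinomials Require Import freeg.

Set Implicit Arguments.
Unset Strict Implicit.
Unset Printing Implicit Defensive.

Import GRing.Theory.
Local Open Scope ring_scope.
Local Open Scope quotient_scope.

(** ** Quotients of vector spaces *)

(* [Quotient.quot] only provides a [zmodType]; this alias of it is an
   [lmodType]. *)
Section QuotientModule.
Variables (k : fieldType) (V : lmodType k) (I : submodClosed V).

Definition submod_pred : {pred V} := fun v => v \in I.

Lemma submod_pred_zmod : zmod_closed submod_pred.
Proof. exact: (GRing.submod_closedB (submodClosedP I)). Qed.

HB.instance Definition _ := GRing.isZmodClosed.Build V submod_pred submod_pred_zmod.

Definition quot_mod : Type := Quotient.quot submod_pred.

HB.instance Definition _ := GRing.Zmodule.on quot_mod.

Definition quot_pi (v : V) : quot_mod := \pi_(Quotient.quot submod_pred) v.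

Definition quot_scale (c : k) (x : quot_mod) : quot_mod :=
  quot_pi (c *: repr (x : Quotient.quot submod_pred)).

Lemma quot_piP v w : quot_pi v = quot_pi w <-> v - w \in I.
Proof.
by have -> : (v - w \in I) = (v == w %[mod Quotient.quot submod_pred]);
  [exact (Quotient.idealrBE submod_pred v w) | split=> [/eqP|/eqP]].
Qed.

Lemma quot_reprK (x : quot_mod) : quot_pi (repr (x : Quotient.quot submod_pred)) = x.
Proof. by rewrite /quot_pi reprK. Qed.

Lemma quot_piD v w : quot_pi (v + w) = quot_pi v + quot_pi w.
Proof. exact: (raddfD (\pi_(Quotient.quot submod_pred))). Qed.

Lemma quot_scaleE c v : quot_scale c (quot_pi v) = quot_pi (c *: v).
Proof.
apply/quot_piP; rewrite -scalerBr rpredZ //.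
by apply/quot_piP; rewrite quot_reprK.
Qed.

Lemma quot_scaleA a b x :
  quot_scale a (quot_scale b x) = quot_scale (a * b) x.
Proof. by rewrite -(quot_reprK x) !quot_scaleE scalerA. Qed.

Lemma quot_scale1 : left_id 1 quot_scale.
Proof. by move=> x; rewrite -(quot_reprK x) quot_scaleE scale1r. Qed.

Lemma quot_scaleDr : right_distributive quot_scale +%R.
Proof.
move=> a x y; rewrite -(quot_reprK x) -(quot_reprK y) -quot_piD.
by rewrite !quot_scaleE scalerDr quot_piD.
Qed.

Lemma quot_scaleDl x : {morph quot_scale^~ x : a b / a + b}.
Proof.
by move=> a b; rewrite -(quot_reprK x) !quot_scaleE scalerDl quot_piD.
Qed.

HB.instance Definition _ := GRing.Zmodule_isLmodule.Build k quot_mod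
  quot_scaleA quot_scale1 quot_scaleDr quot_scaleDl.

Lemma quot_pi_is_linear : linear quot_pi.
Proof. by move=> c v w; rewrite quot_piD -quot_scaleE. Qed.

HB.instance Definition _ :=
  GRing.isLinear.Build k V quot_mod _ quot_pi quot_pi_is_linear.

End QuotientModule.

Section Cokernel.
Variables (k : fieldType) (U V : lmodType k) (f : {linear U -> V}).

Definition image_pred : {pred V} := fun v => `[< exists u, f u = v >].

Lemma image_submod : submod_closed image_pred.
Proof.
split; first by apply/asboolP; exists 0; rewrite linear0.
move=> c _ _ /asboolP[u <-] /asboolP[v <-].
by apply/asboolP; exists (c *: u + v); rewrite linearP.
Qed.

HB.instance Definition _ := GRing.isSubmodClosed.Build k V image_pred image_submod.

Definition coker : lmodType k := quot_mod image_pred.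

Definition coker_map : {linear V -> coker} := quot_pi image_pred.

End Cokernel.

(** ** Tensor products over a field *)

Lemma fglift_linear (k : fieldType) (K : choiceType) (W : lmodType k) (g : K -> W) :
  linear (@fglift k W K g).
Proof.
pose L := GRing.isAdditive.Build _ _ (@fglift k W K g) (lift_is_additive g).
pose G : {additive _ -> _} := HB.pack (@fglift k W K g) L.
have GE D : fglift g D = \sum_(z <- dom D) coeff z D *: g z.
  rewrite -{1}(freeg_sumE D) -[fglift g]/(G : _ -> _) raddf_sum.
  by apply: eq_bigr => z _; rewrite /G /= liftU.
have GZ c D : fglift g (c *: D) = c *: fglift g D.
  rewrite -{1}(freeg_sumE D) scaler_sumr -[in LHS](_ : G =1 fglift g) // raddf_sum.
  rewrite GE scaler_sumr; apply: eq_bigr => z _ /=.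
  have -> : c *: << coeff z D *g z >> = << c * coeff z D *g z >> :> {freeg K / k}.
    by apply/eqP/freeg_eqP=> y; rewrite coeffZ !coeffU mulrA.
  by rewrite liftU scalerA.
by move=> c x y; rewrite -GZ -[fglift g]/(G : _ -> _) raddfD.
Qed.

Section Tensor.
Variables (k : fieldType) (U V : lmodType k).

Inductive tensor_rel : {freeg (U * V) / k} -> Prop :=
| TensorRel0 : tensor_rel 0
| TensorRelP c x y :
    tensor_rel x -> tensor_rel y -> tensor_rel (c *: x + y)
| TensorRelL c u u' v :
    tensor_rel (<< (c *: u + u', v) >> - c *: << (u, v) >> - << (u', v) >>)
| TensorRelR c u v v' :
    tensor_rel (<< (u, c *: v + v') >> - c *: << (u, v) >> - << (u, v') >>).

Definition tensor_pred : {pred {freeg (U * V) / k}} :=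
  fun x => `[< tensor_rel x >].

Lemma tensor_submod : submod_closed tensor_pred.
Proof.
split; first by apply/asboolP; exact: TensorRel0.
by move=> c x y /asboolP hx /asboolP hy; apply/asboolP; exact: TensorRelP.
Qed.

HB.instance Definition _ :=
  GRing.isSubmodClosed.Build k {freeg (U * V) / k} tensor_pred tensor_submod.

Definition tensor : lmodType k := quot_mod tensor_pred.

Definition tens (u : U) (v : V) : tensor := quot_pi tensor_pred << (u, v) >>.

(* The map on the tensor product induced by [f], i.e. [f u_(1) u_(2)] in
   Sweedler notation. It is only meaningful for bilinear [f], for which it does
   not depend on the representative: see [tlift_tens] and [tlift_linear]. *)
Definition tlift (W : lmodType k) (f : U -> V -> W) (t : tensor) : W :=
  fglift (fun p : U * V => f p.1 p.2)
    (repr (t : Quotient.quot (submod_pred tensor_pred))).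

Section Universal.
Variables (W : lmodType k) (f : U -> V -> W).
Hypothesis f_linl : forall v, linear (f^~ v).
Hypothesis f_linr : forall u, linear (f u).

Lemma tlift_pi x :
  tlift f (quot_pi tensor_pred x) = fglift (fun p : U * V => f p.1 p.2) x.
Proof.
have [L linL] : exists L : {linear {freeg (U * V) / k} -> W},
    forall z, L z = fglift (fun p : U * V => f p.1 p.2) z.
  pose M := GRing.isLinear.Build k _ _ _ _
    (fglift_linear (fun p : U * V => f p.1 p.2)).
  pose L : {linear _ -> _} :=
    HB.pack (@fglift k W _ (fun p : U * V => f p.1 p.2)) M.
  by exists L.
suff ker z : tensor_rel z -> L z = 0.
  rewrite /tlift -!linL; apply/eqP; rewrite -subr_eq0 -linearB; apply/eqP.
  apply: ker; apply/asboolP; apply: (quot_piP tensor_pred _ _).1.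
  exact: quot_reprK.
have L1 u v : L << (u, v) >> = f u v by rewrite linL liftU scale1r.
elim=> {z} [|c z w _ hz _ hw|c u u' v|c u v v'].
- exact: linear0.
- by rewrite linearP hz hw scaler0 addr0.
- by rewrite 2!linearB linearZ /= !L1 f_linl addrAC addrK subrr.
- by rewrite 2!linearB linearZ /= !L1 f_linr addrAC addrK subrr.
Qed.

Lemma tlift_tens u v : tlift f (tens u v) = f u v.
Proof. by rewrite tlift_pi liftU scale1r. Qed.

Lemma tlift_linear : linear (tlift f).
Proof.
move=> c x y; rewrite -(quot_reprK x) -(quot_reprK y) -linearP !tlift_pi.
exact: fglift_linear.
Qed.

End Universal.
End Tensor.

Notation "u ⊗ v" := (tens u v) (at level 40, left associativity) : ring_scope.

(** ** Hopf algebras *)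

Record hopf_algebra (k : fieldType) (A : algType k) := HopfAlgebra {
  coprod : {linear A -> tensor A A};
  counit : {linear A -> k^o};
  antipode : {linear A -> A};
  coprodA : forall a,
    tlift (fun x y => tlift (fun x1 x2 => x1 ⊗ (x2 ⊗ y)) (coprod x)) (coprod a)
    = tlift (fun x y => x ⊗ coprod y) (coprod a);
  counitl : forall a, tlift (fun x y => counit x *: y) (coprod a) = a;
  counitr : forall a, tlift (fun x y => counit y *: x) (coprod a) = a;
  coprod1 : coprod 1 = 1 ⊗ 1;
  coprodM : forall a b, coprod (a * b) =
    tlift (fun a1 a2 =>
      tlift (fun b1 b2 => (a1 * b1) ⊗ (a2 * b2)) (coprod b)) (coprod a);
  counit1 : counit 1 = 1;
  counitM : forall a b, counit (a * b) = counit a * counit b :> k;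
  antipodel : forall a,
    tlift (fun x y => antipode x * y) (coprod a) = counit a *: 1;
  antipoder : forall a,
    tlift (fun x y => x * antipode y) (coprod a) = counit a *: 1
}.

Section HopfActions.
Variables (k : fieldType) (A : algType k) (H : hopf_algebra A).

(* g ▷ a = a_(1) g(a_(2)) *)
Definition hact (g : A -> k) (a : A) : A :=
  tlift (fun a1 a2 => g a2 *: a1) (coprod H a).

Definition right_integral (l : {linear A -> k^o}) : Prop :=
  forall a, tlift (fun a1 a2 => l a1 *: a2) (coprod H a) = l a *: 1.

End HopfActions.

(** ** Bimodules and right module maps *)

(* [k] acts centrally, through the [lmodType] structure of the carrier. *)
Record bimodule (k : fieldType) (A : algType k) := Bimodule {
  bimod_car :> lmodType k;
  lact : A -> bimod_car -> bimod_car;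
  ract : bimod_car -> A -> bimod_car;
  lact_linearl : forall w, linear (lact^~ w);
  lact_linearr : forall a, linear (lact a);
  ract_linearl : forall a, linear (ract^~ a);
  ract_linearr : forall w, linear (ract w);
  lact1 : forall w, lact 1 w = w;
  lactM : forall a b w, lact (a * b) w = lact a (lact b w);
  ract1 : forall w, ract w 1 = w;
  ractM : forall w a b, ract w (a * b) = ract (ract w a) b;
  lractA : forall a w b, ract (lact a w) b = lact a (ract w b)
}.

Section RegularBimodule.
Variables (k : fieldType) (A : algType k).

Lemma reg_linearl (x : A) : linear (fun a : A => a * x).
Proof. by move=> c a b; rewrite mulrDl scalerAl. Qed.

Lemma reg_linearr (x : A) : linear (fun a : A => x * a).
Proof. by move=> c a b; rewrite mulrDr scalerAr. Qed.

Definition regular_bimodule : bimodule A :=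
  @Bimodule k A A *%R *%R reg_linearl reg_linearr reg_linearl reg_linearr
    (@mul1r A) (fun a b w => esym (mulrA a b w))
    (@mulr1 A) (@mulrA A) (fun a w b => esym (mulrA a w b)).

End RegularBimodule.

Section ModuleMaps.
Variables (k : fieldType) (A : algType k) (M : bimodule A).

Definition left_mod_map (f : M -> A) : Prop :=
  (forall x y, f (x + y) = f x + f y) /\ (forall a x, f (lact a x) = a * f x).

Definition right_mod_map (f : M -> A) : Prop :=
  (forall x y, f (x + y) = f x + f y) /\ (forall x a, f (ract x a) = f x * a).

Definition rhom_pred : {pred M -> A} := fun f => `[< right_mod_map f >].

Lemma rhom_pred_submod : submod_closed rhom_pred.
Proof.
split.
  apply/asboolP; split=> [x y|x a]; first by rewrite /= addr0.
  by rewrite /= mul0r.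
move=> c f g /asboolP[fD fM] /asboolP[gD gM]; apply/asboolP.
split=> [x y|x a].
  by rewrite !fctE fD gD scalerDr addrACA.
by rewrite !fctE fM gM mulrDl scalerAl.
Qed.

HB.instance Definition _ :=
  GRing.isSubmodClosed.Build k (M -> A) rhom_pred rhom_pred_submod.

(* Hom_A(M, A), as a subspace of the space of all maps [M -> A]. *)
Record rhom := Rhom { rhom_fun :> M -> A; rhomP : rhom_fun \in rhom_pred }.

HB.instance Definition _ := [isSub for rhom_fun].
HB.instance Definition _ := [Choice of rhom by <:].
HB.instance Definition _ := [SubChoice_isSubLmodule of rhom by <:].

Definition mk_rhom (f : M -> A) (fP : right_mod_map f) : rhom :=
  Rhom (introT (asboolP _) fP : f \in rhom_pred).

Lemma rhom_ext (f g : rhom) : f =1 g -> f = g.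
Proof. by move=> fg; apply/val_inj/funext. Qed.

Lemma rhomD (f : rhom) x y : f (x + y) = f x + f y.
Proof. by have /asboolP[fD fM] := rhomP f. Qed.

Lemma rhomM (f : rhom) x a : f (ract x a) = f x * a.
Proof. by have /asboolP[fD fM] := rhomP f. Qed.

Lemma rhomZ (f : rhom) c x : f (c *: x) = c *: f x.
Proof.
have -> : c *: x = ract x c%:A.
  have := ract_linearr x c 1 0.
  have -> : ract x 0 = 0.
    by have := ract_linearr x (-1) 0 0; rewrite scaler0 addr0 scaleN1r addNr.
  by rewrite !addr0 ract1.
by rewrite rhomM -scalerAr mulr1.
Qed.

Lemma rhom_ract_subproof (f : rhom) (a : A) :
  right_mod_map (fun w => f (lact a w)).
Proof.
split=> [x y|x b].
  by rewrite -rhomD -[x in LHS]scale1r lact_linearr scale1r.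
by rewrite -lractA rhomM.
Qed.

(* (f a)(w) = f (a w) *)
Definition rhom_ract (f : rhom) (a : A) : rhom :=
  mk_rhom (rhom_ract_subproof f a).

End ModuleMaps.

(** ** Differential calculi *)

Record fodc (k : fieldType) (A : algType k) := Fodc {
  fodc_bimod :> bimodule A;
  fodc_d : {linear A -> fodc_bimod};
  fodc_leibniz : forall a b,
    fodc_d (a * b) = ract (fodc_d a) b + lact a (fodc_d b);
  fodc_span : forall w : fodc_bimod, exists s : seq (A * A),
    w = \sum_(p <- s) lact p.1 (fodc_d p.2)
}.

Section Calculus.
Variables (k : fieldType) (A : algType k) (Om : fodc A).
Local Notation d := (fodc_d Om).

(* Such a map exists exactly when the calculus is left covariant, and it is then
   unique, by [fodc_span]. *)
Definition left_coaction (H : hopf_algebra A)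
    (DL : {linear Om -> tensor A Om}) : Prop :=
  forall a b, DL (lact a (d b)) =
    tlift (fun a1 a2 =>
      tlift (fun b1 b2 => (a1 * b1) ⊗ lact a2 (d b2)) (coprod H b))
      (coprod H a).

Definition left_basis (n : nat) (w : 'I_n -> Om) : Prop :=
  forall x : Om, exists! c : {ffun 'I_n -> A}, x = \sum_i lact (c i) (w i).

Definition right_basis (n : nat) (w : 'I_n -> Om) : Prop :=
  forall x : Om, exists! c : {ffun 'I_n -> A}, x = \sum_i ract (w i) (c i).

Definition left_invariant_basis (DL : {linear Om -> tensor A Om})
    (n : nat) (w : 'I_n -> Om) : Prop :=
  [/\ forall i, DL (w i) = 1 ⊗ w i, left_basis w & right_basis w].

Record hom_connection := HomConnection {
  hconn :> {linear rhom Om -> A};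
  hconn_leibniz : forall (f : rhom Om) a,
    hconn (rhom_ract f a) = hconn f * a + f (d a)
}.

(** *** Differential graded algebras extending the calculus *)

Definition dga_deg (B : nat -> bimodule A) (n : nat) : bimodule A :=
  match n with
  | 0 => regular_bimodule A
  | 1 => Om
  | m.+2 => B m
  end.

(* Degrees 0 and 1 are A and Omega^1(A) by definition; [dga_higher m] is the
   component of degree m + 2. The product takes values in any degree [p]
   provably equal to the sum of the degrees, which avoids casts. *)
Record dga_extension := DgaExtension {
  dga_higher : nat -> bimodule A;
  dga_mul : forall m n p, (m + n)%N = p ->
    dga_deg dga_higher m -> dga_deg dga_higher n -> dga_deg dga_higher p;
  dga_d : forall n, {linear dga_deg dga_higher n -> dga_deg dga_higher n.+1};
  dga_mul_linearl : forall m n p (e : (m + n)%N = p) y,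
    linear (fun x => dga_mul e x y);
  dga_mul_linearr : forall m n p (e : (m + n)%N = p) x,
    linear (dga_mul e x);
  dga_mulA : forall m n p mn np q (e1 : (m + n)%N = mn) (e2 : (mn + p)%N = q)
      (e3 : (n + p)%N = np) (e4 : (m + np)%N = q) x y z,
    dga_mul e2 (dga_mul e1 x y) z = dga_mul e4 x (dga_mul e3 y z);
  dga_mul0n : forall n (e : (0 + n)%N = n) (a : A) x,
    dga_mul e (a : dga_deg dga_higher 0) x = lact a x;
  dga_muln0 : forall n (e : (n + 0)%N = n) x (a : A),
    dga_mul e x (a : dga_deg dga_higher 0) = ract x a;
  dga_d0 : forall a : A, dga_d 0 a = d a;
  dga_dd : forall n (x : dga_deg dga_higher n), dga_d n.+1 (dga_d n x) = 0;
  dga_leibniz : forall m n p (e : (m + n)%N = p)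
      (e1 : (m.+1 + n)%N = p.+1) (e2 : (m + n.+1)%N = p.+1) x y,
    dga_d p (dga_mul e x y) =
      dga_mul e1 (dga_d m x) y + (-1) ^+ m *: dga_mul e2 x (dga_d n y)
}.

Section Flatness.
Variables (E : dga_extension) (nabla : hom_connection).

Definition dga_comp (n : nat) : bimodule A := dga_deg (dga_higher E) n.

Lemma dga_rmul_subproof m n p (e : (n + m)%N = p) (f : rhom (dga_comp p))
    (w : dga_comp n) :
  right_mod_map (fun w' : dga_comp m => f (dga_mul e w w')).
Proof.
split=> [x y|x a].
  by rewrite -rhomD -[x in LHS]scale1r dga_mul_linearr scale1r.
rewrite -rhomM; congr (rhom_fun f _).
rewrite -(dga_muln0 (addn0 p)) -(dga_muln0 (addn0 m)).
by rewrite (dga_mulA e (addn0 p) (addn0 m) e).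
Qed.

(* (f w)(w') = f (w w') *)
Definition dga_rmul m n p (e : (n + m)%N = p) (f : rhom (dga_comp p))
    (w : dga_comp n) : rhom (dga_comp m) :=
  mk_rhom (dga_rmul_subproof e f w).

Definition nabla_fun (n : nat) (f : rhom (dga_comp n.+1)) (w : dga_comp n) : A :=
  nabla (dga_rmul (addn1 n) f w : rhom (dga_comp 1))
  + (-1) ^+ n.+1 * f (dga_d E n w).

Lemma nabla_fun_right n (f : rhom (dga_comp n.+1)) : right_mod_map (nabla_fun f).
Proof.
split=> [x y|x a]; rewrite /nabla_fun.
  have -> : dga_rmul (addn1 n) f (x + y) =
      dga_rmul (addn1 n) f x + dga_rmul (addn1 n) f y :> rhom (dga_comp 1).
    apply: rhom_ext => w.
    rewrite -[RHS]/(f (dga_mul _ x w) + f (dga_mul _ y w)) -rhomD /=.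
    congr (rhom_fun f _).
    by have := dga_mul_linearl (addn1 n) w 1 x y; rewrite !scale1r.
  by rewrite !linearD rhomD mulrDr addrACA.
have -> : dga_rmul (addn1 n) f (ract x a) =
    @rhom_ract _ _ Om (dga_rmul (addn1 n) f x : rhom (dga_comp 1)) a
    :> rhom (dga_comp 1).
  apply: rhom_ext => w /=; congr (rhom_fun f _).
  rewrite -(dga_muln0 (addn0 n)) -(dga_mul0n (n := 1%N) (add0n 1)).
  exact: dga_mulA.
rewrite hconn_leibniz /= -(dga_muln0 (addn0 n)) (dga_leibniz _ (addn0 n.+1) (addn1 n)) dga_muln0 dga_d0.
rewrite rhomD rhomM rhomZ mulrDl mulrDr mulrA -!addrA; congr (_ + _).
rewrite addrCA -[RHS]addr0; congr (_ + _).
rewrite exprS -(signr_odd A n) -(signr_odd k n); case: (odd n) => /=.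
  by rewrite !expr1 mulrNN !mul1r scaleN1r subrr.
by rewrite !expr0 mulr1 mulN1r scale1r subrr.
Qed.

Definition nabla_n n (f : rhom (dga_comp n.+1)) : rhom (dga_comp n) :=
  mk_rhom (nabla_fun_right f).

Definition flat : Prop :=
  forall f : rhom (dga_comp 2), nabla (nabla_n f : rhom (dga_comp 1)) = 0.

End Flatness.
End Calculus.

(* Main.v *)
From HB Require Import structures.
Require Import Defs.
From mathcomp Require Import all_boot all_order all_algebra.
From mathcomp Require Import boolp functions.
From mathcomp.multinomials Require Import freeg.

Set Implicit Arguments.
Unset Strict Implicit.
Unset Printing Implicit Defensive.

Import GRing.Theory.
Local Open Scope ring_scope.

(** Write [d a = sum_i l_i(d a) w_i] and [w_i a = sum_j s_ij(a) w_j] in the left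
    invariant basis [w]. Left covariance forces the coefficient operators to
    commute with the coproduct, so each of them has the form
    [a |-> a_(1) g(a_(2))] for its own composite [g] with the counit
    ([coefficient_coaction_left], [lam_d], [lam_ract]). All the data of the
    calculus are thereby encoded in functionals on [A]: the [chi_i] attached to
    [l_i o d], and the [f_ij] attached to [s_ij]. Associativity of the right
    action makes [f] a homomorphism from [A] to matrices, and the Leibniz rule
    makes [chi] a derivation twisted by [f]:
    [chi_j(ab) = sum_i chi_i(a) f_ij(b) + eps(a) chi_j(b)]
    ([twistM], [tangentM]).

    Elements of [Hom_A(Omega^1, A)] are right linear, so their behaviour under
    [f |-> f a] is governed by the opposite commutation rule
    [a w_i = sum_j w_j t_ij(a)]. The transposed matrix of functionals of [t] is
    the convolution inverse of the transpose of [f], so those functionals are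
    [f_ij o S^-1] ([cotwistE]). The
    Leibniz rule for [nabla f = sum_i (chi_i o S^-2) |> f(w_i)] then follows
    from two convolution identities,
    [sum_l (f_il o S^-2) * (f_lj o S^-1) = delta_ij eps] and
    [sum_i (chi_i o S^-2) * (f_ij o S^-1) = sum_i (f_ij o S^-1) * chi_i];
    they hold because [S^-2(a_(1)) S^-1(a_(2))] and [a_(2) S^-1(a_(1))] are both
    [eps(a) 1], and both sides of the second one equal [- chi_j o S^-1]. The
    twist by [S^-2] is there to make these cancellations possible.
    The first formula for [nabla] is the same one, since [S^2] is a coalgebra
    automorphism ([antipode2_hact]).

    Uniqueness: a hom-connection is determined by its values on a set of
    generators of the right [A]-module [Hom_A(Omega^1, A)], and the [xi_i]
    generate it ([rhom_generated]), because the matrix of operators [t_ij] has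
    the right inverse with functionals [f_ij o S^-2].

    Integral: if [l] is a right integral then [l(g |> a) = l(a) g(1)], while
    [chi_i(1) = 0]; so [l] vanishes on the image of [nabla] and descends to the
    cokernel, uniquely since [A] maps onto the cokernel. *)

(** * Linear maps and tensors *)

Definition bilinear_map (k : fieldType) (U V W : lmodType k) (F : U -> V -> W) :=
  (forall v, linear (F^~ v)) /\ (forall u, linear (F u)).

Lemma linear_bigsum (k : fieldType) (U W : lmodType k) (I : Type) (s : seq I)
    (F : I -> U -> W) :
  (forall i, linear (F i)) -> linear (fun x => \sum_(i <- s) F i x).
Proof.
move=> linF c x y; rewrite scaler_sumr -big_split /=.
by apply: eq_bigr => i _; rewrite linF.
Qed.

(** For maps whose linearity depends on hypotheses in context. The bundled map
    unfolds to the original one, so the two can be exchanged by conversion. *)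
Definition mk_linear (k : fieldType) (U W : lmodType k) (f : U -> W)
    (linf : linear f) : {linear U -> W} :=
  HB.pack f (GRing.isLinear.Build k _ _ _ _ linf).

Lemma linear_scaleE (k : fieldType) (U W : lmodType k) (f : U -> W) :
  linear f -> forall c x, f (c *: x) = c *: f x.
Proof. by move=> linf c x; rewrite -[f]/(mk_linear linf : _ -> _) linearZ. Qed.

Lemma linear_sumE (k : fieldType) (U W : lmodType k) (f : U -> W) :
  linear f -> forall (I : Type) (s : seq I) (F : I -> U),
  f (\sum_(i <- s) F i) = \sum_(i <- s) f (F i).
Proof.
by move=> linf I s F; rewrite -[f]/(mk_linear linf : _ -> _) linear_sum.
Qed.

Lemma bilinear_map_comp (k : fieldType) (U V U' V' W : lmodType k) (F : U -> V -> W)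
    (f : {linear U' -> U}) (g : {linear V' -> V}) :
  bilinear_map F -> bilinear_map (fun x y => F (f x) (g y)).
Proof. by move=> bF; split=> [v c x y|u c x y]; rewrite /= linearP (bF.1, bF.2). Qed.

Lemma bilinear_map_swap (k : fieldType) (U V W : lmodType k) (F : U -> V -> W) :
  bilinear_map F -> bilinear_map (fun y x => F x y).
Proof. by case. Qed.

Section Tensors.
Variables (k : fieldType) (U V : lmodType k).

Lemma tens_bilinear : bilinear_map (@tens k U V).
Proof.
split=> [v c u u'|u c v v']; rewrite /tens -linearP; apply/quot_piP/asboolP.
  by rewrite opprD addrA; apply: TensorRelL.
by rewrite opprD addrA; apply: TensorRelR.
Qed.

(** The witness is a type-level choice, so that one finite sum of pure tensors
    can be fixed for each tensor and used as its Sweedler components. *)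
Lemma tensor_spanned (t : tensor U V) :
  {s : seq (U * V) | t = \sum_(p <- s) p.1 ⊗ p.2}.
Proof.
apply: cid; rewrite -(quot_reprK t); set x := (repr _).
exists [seq (coeff p x *: p.1, p.2) | p <- dom x].
rewrite big_map -{1}(freeg_sumE x) raddf_sum; apply: eq_bigr => -[u v] _ /=.
rewrite (linear_scaleE (tens_bilinear.1 v)) /tens -linearZ /=; congr (quot_pi _ _).
by apply/eqP/freeg_eqP => y; rewrite coeffZ !coeffU mul1r.
Qed.

Lemma tlift_sum (W : lmodType k) (F : U -> V -> W) (s : seq (U * V)) :
  bilinear_map F ->
  tlift F (\sum_(p <- s) p.1 ⊗ p.2) = \sum_(p <- s) F p.1 p.2.
Proof.
move=> [Fl Fr]; rewrite (linear_sumE (tlift_linear Fl Fr)).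
by apply: eq_bigr => p _; rewrite tlift_tens.
Qed.

End Tensors.


Section TensorMap.
Variables (k : fieldType) (U1 U2 V1 V2 W1 W2 : lmodType k).
Variables (m1 : U1 -> V1 -> W1) (m2 : U2 -> V2 -> W2).

(** The product of two bilinear operations. With multiplication on both sides it
    is the product of the algebra [A ⊗ A]; with a bimodule action on the right
    it is the action of [A ⊗ A] on [A ⊗ M]. *)
Definition tmap2 (s : tensor U1 U2) (t : tensor V1 V2) : tensor W1 W2 :=
  tlift (fun u1 u2 => tlift (fun v1 v2 => m1 u1 v1 ⊗ m2 u2 v2) t) s.

Hypotheses (bm1 : bilinear_map m1) (bm2 : bilinear_map m2).

Lemma tmap2_bilinear_inner u1 u2 :
  bilinear_map (fun v1 v2 => m1 u1 v1 ⊗ m2 u2 v2).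
Proof.
have [tl tr] := tens_bilinear W1 W2.
by split=> [v c x y|u c x y]; rewrite /= ?bm1.2 ?bm2.2 ?tl ?tr.
Qed.

Lemma tmap2_bilinear_outer t :
  bilinear_map (fun u1 u2 => tlift (fun v1 v2 => m1 u1 v1 ⊗ m2 u2 v2) t).
Proof.
have [tl tr] := tens_bilinear W1 W2; have [s ->] := tensor_spanned t.
by split=> [v c x y|u c x y]; rewrite !(tlift_sum _ (tmap2_bilinear_inner _ _));
  rewrite scaler_sumr -big_split; apply: eq_bigr => p _ /=;
  rewrite ?bm1.1 ?bm2.1 ?tl ?tr.
Qed.

Lemma tmap2_bilinear : bilinear_map tmap2.
Proof.
split=> [t|s c t t'].
  exact: tlift_linear (tmap2_bilinear_outer t).1 (tmap2_bilinear_outer t).2.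
have [r ->] := tensor_spanned s.
rewrite /tmap2 !(tlift_sum _ (tmap2_bilinear_outer _)) scaler_sumr -big_split.
apply: eq_bigr => p _.
exact: tlift_linear (tmap2_bilinear_inner _ _).1 (tmap2_bilinear_inner _ _).2 _ _ _.
Qed.

Lemma tmap2_sum (s : seq (U1 * U2)) (t : seq (V1 * V2)) :
  tmap2 (\sum_(p <- s) p.1 ⊗ p.2) (\sum_(q <- t) q.1 ⊗ q.2) =
  \sum_(p <- s) \sum_(q <- t) m1 p.1 q.1 ⊗ m2 p.2 q.2.
Proof.
rewrite /tmap2 (tlift_sum _ (tmap2_bilinear_outer _)).
by apply: eq_bigr => p _; rewrite (tlift_sum _ (tmap2_bilinear_inner _ _)).
Qed.

Lemma tmap2_tens u1 u2 v1 v2 :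
  tmap2 (u1 ⊗ u2) (v1 ⊗ v2) = m1 u1 v1 ⊗ m2 u2 v2.
Proof. by have := tmap2_sum [:: (u1, u2)] [:: (v1, v2)]; rewrite !big_seq1. Qed.

End TensorMap.

Lemma mul_bilinear (k : fieldType) (A : algType k) :
  @bilinear_map k A A A *%R.
Proof.
by split=> [v c x y|u c x y]; rewrite ?mulrDl ?mulrDr -?scalerAl -?scalerAr.
Qed.

Lemma lact_bilinear (k : fieldType) (A : algType k) (M : bimodule A) :
  bilinear_map (@lact k A M).
Proof. split; [exact: lact_linearl | exact: lact_linearr]. Qed.

Lemma ract_bilinear (k : fieldType) (A : algType k) (M : bimodule A) :
  bilinear_map (@ract k A M).
Proof. split; [exact: ract_linearl | exact: ract_linearr]. Qed.


(** * Sweedler calculus and the antipode *)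

Section Sweedler.
Variables (k : fieldType) (A : algType k) (H : hopf_algebra A).
Local Notation S := (antipode H).
Local Notation eps := (counit H).

(** A chosen list of components [(a_(1), a_(2))]. The choice is harmless under a
    bilinear [F], for which [sum F(a_(1), a_(2))] is the value of a linear map
    at the coproduct. *)
Definition sw (a : A) : seq (A * A) := sval (tensor_spanned (coprod H a)).

Lemma sw_coprod a : coprod H a = \sum_(p <- sw a) p.1 ⊗ p.2.
Proof. exact: svalP (tensor_spanned (coprod H a)). Qed.

Lemma tlift_sw (W : lmodType k) (F : A -> A -> W) a :
  bilinear_map F -> tlift F (coprod H a) = \sum_(p <- sw a) F p.1 p.2.
Proof. by move=> bF; rewrite sw_coprod tlift_sum. Qed.

Lemma sw_linear (W : lmodType k) (F : A -> A -> W) :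
  bilinear_map F -> linear (fun a => \sum_(p <- sw a) F p.1 p.2).
Proof.
move=> bF c a b; rewrite -!tlift_sw // linearP.
by case: bF => Fl Fr; apply: tlift_linear.
Qed.

(** Coassociativity tested against an arbitrary trilinear map [F]: the linear map
    that [F] induces on [A ⊗ (A ⊗ A)] is applied to both sides of the
    coassociativity law. *)
Lemma sw_assoc (W : lmodType k) (F : A -> A -> A -> W) a :
  (forall x, bilinear_map (F x)) ->
  (forall y z, linear (fun x => F x y z)) ->
  \sum_(p <- sw a) \sum_(q <- sw p.1) F q.1 q.2 p.2 =
  \sum_(p <- sw a) \sum_(q <- sw p.2) F p.1 q.1 q.2.
Proof.
move=> bF lF.
pose G x (t : tensor A A) := tlift (F x) t.
have bG : bilinear_map G.
  split=> [t c x y|x]; last exact: tlift_linear (bF x).1 (bF x).2.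
  have [s ->] := tensor_spanned t; rewrite /G !tlift_sum //.
  by rewrite scaler_sumr -big_split /=; apply: eq_bigr => p _; rewrite lF.
pose T := tlift G; have lT : linear T := tlift_linear bG.1 bG.2.
have [tl tr] := tens_bilinear A A.
have [tl' tr'] := tens_bilinear A (tensor A A).
have inner (y : A) : @bilinear_map k A A _ (fun x1 x2 => x1 ⊗ (x2 ⊗ y)).
  by split=> [v c u u'|u c v v']; [rewrite /= tl' | rewrite /= tl tr'].
have b1 : @bilinear_map k A A _ (fun x y => tlift (fun x1 x2 => x1 ⊗ (x2 ⊗ y)) (coprod H x)).
  split=> [y c x x'|x c y y'].
    by rewrite linearP; apply: tlift_linear (inner y).1 (inner y).2 _ _ _.
  rewrite !tlift_sw // scaler_sumr -big_split /=.
  by apply: eq_bigr => p _; rewrite tr tr'.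
have b2 : @bilinear_map k A A _ (fun x y => x ⊗ coprod H y).
  by split=> [v c u u'|u c v v']; [rewrite /= tl' | rewrite linearP tr'].
have TF x y z : T (x ⊗ (y ⊗ z)) = F x y z.
  by rewrite /T (tlift_tens bG.1 bG.2) /G (tlift_tens (bF x).1 (bF x).2).
have := congr1 T (coprodA H a).
rewrite (tlift_sw _ b1) (tlift_sw _ b2) !(linear_sumE lT) => E.
transitivity (\sum_(p <- sw a)
    T (tlift (fun x1 x2 => x1 ⊗ (x2 ⊗ p.2)) (coprod H p.1))).
  apply: eq_bigr => p _; rewrite (tlift_sw _ (inner p.2)) (linear_sumE lT).
  by apply: eq_bigr => q _; rewrite TF.
rewrite E; apply: eq_bigr => p _; rewrite sw_coprod.
rewrite (linear_sumE (tr' p.1)) (linear_sumE lT).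
by apply: eq_bigr => q _; rewrite TF.
Qed.

Lemma sw_mul (W : lmodType k) (F : A -> A -> W) a b :
  bilinear_map F ->
  \sum_(p <- sw (a * b)) F p.1 p.2 =
  \sum_(p <- sw a) \sum_(q <- sw b) F (p.1 * q.1) (p.2 * q.2).
Proof.
move=> bF; pose T := tlift F.
have lT : linear T := tlift_linear bF.1 bF.2.
have TF x y : T (x ⊗ y) = F x y by rewrite /T (tlift_tens bF.1 bF.2).
have := congr1 T (coprodM H a b).
rewrite -[X in _ = T X -> _]/(tmap2 *%R *%R (coprod H a) (coprod H b)).
rewrite !sw_coprod (tmap2_sum (mul_bilinear _) (mul_bilinear _)).
rewrite !(linear_sumE lT) => E.
transitivity (\sum_(p <- sw (a * b)) T (p.1 ⊗ p.2)).
  by apply: eq_bigr => p _; rewrite TF.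
rewrite E; apply: eq_bigr => p _; rewrite (linear_sumE lT).
by apply: eq_bigr => q _; rewrite TF.
Qed.

Lemma sw_one (W : lmodType k) (F : A -> A -> W) :
  bilinear_map F -> \sum_(p <- sw 1) F p.1 p.2 = F 1 1.
Proof. by move=> bF; rewrite -tlift_sw // coprod1 (tlift_tens bF.1 bF.2). Qed.

Lemma bilinear_evall (f : {linear A -> k^o}) :
  bilinear_map (fun x y => f x *: y : A).
Proof.
split=> [v c u u'|u c v v'].
  by rewrite /= linearP scalerDl scalerA.
by rewrite scalerDr !scalerA mulrC.
Qed.

Lemma bilinear_evalr (f : {linear A -> k^o}) :
  bilinear_map (fun x y => f y *: x : A).
Proof.
split=> [v c u u'|u c v v'].
  by rewrite /= scalerDr !scalerA mulrC.
by rewrite /= linearP scalerDl scalerA.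
Qed.

Lemma sw_counitl a : \sum_(p <- sw a) eps p.1 *: p.2 = a.
Proof. by rewrite -[RHS](counitl H) (tlift_sw _ (bilinear_evall _)). Qed.

Lemma sw_counitr a : \sum_(p <- sw a) eps p.2 *: p.1 = a.
Proof. by rewrite -[RHS](counitr H) (tlift_sw _ (bilinear_evalr _)). Qed.

Lemma bilinear_mul (f g : {linear A -> A}) : bilinear_map (fun x y => f x * g y).
Proof.
split=> [v c u u'|u c v v'].
  by rewrite /= linearP mulrDl scalerAl.
by rewrite /= linearP mulrDr scalerAr.
Qed.

Lemma sw_antipodel a : \sum_(p <- sw a) S p.1 * p.2 = eps a *: 1.
Proof. by rewrite -antipodel (tlift_sw _ (bilinear_mul _ idfun)). Qed.

Lemma sw_antipoder a : \sum_(p <- sw a) p.1 * S p.2 = eps a *: 1.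
Proof. by rewrite -antipoder (tlift_sw _ (bilinear_mul idfun _)). Qed.

(** A left inverse of [G] under convolution equals any right inverse, by the
    usual computation [F = F * (G * P) = (F * G) * P = P]. Associativity is
    required only on the values of the three maps, since one of the products
    used below is associative only there. *)
Lemma conv_inverse_unique (W : lmodType k) (mu : W -> W -> W) (e : W)
    (F G P : A -> W) :
  bilinear_map mu -> linear F -> linear G -> linear P ->
  (forall x y z, mu (F x) (mu (G y) (P z)) = mu (mu (F x) (G y)) (P z)) ->
  (forall x, mu (F x) e = F x) -> (forall x, mu e (P x) = P x) ->
  (forall a, \sum_(p <- sw a) mu (F p.1) (G p.2) = eps a *: e) ->
  (forall a, \sum_(p <- sw a) mu (G p.1) (P p.2) = eps a *: e) ->
  F =1 P.
Proof.
move=> [mul mur] linF linG linP muA mue mule FG GP a.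
transitivity (\sum_(p <- sw a) \sum_(q <- sw p.2) mu (F p.1) (mu (G q.1) (P q.2))).
  rewrite -{1}(sw_counitr a) (linear_sumE linF); apply: eq_bigr => p _.
  by rewrite -(linear_sumE (mur _)) GP (linear_scaleE (mur _)) mue (linear_scaleE linF).
rewrite -(sw_assoc (F := fun x y z => mu (F x) (mu (G y) (P z)))).
- rewrite -{2}(sw_counitl a) (linear_sumE linP); apply: eq_bigr => p _.
  under eq_bigr do rewrite muA.
  by rewrite -(linear_sumE (mul (P p.2))) FG (linear_scaleE (mul _)) mule (linear_scaleE linP).
- move=> x; split=> [z c y y'|y c z z'].
    by rewrite linG mul mur.
  by rewrite linP !mur.
- by move=> y z c x x'; rewrite linF mul.
Qed.

Lemma antipode1 : S 1 = 1.
Proof.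
have := sw_antipodel 1; rewrite counit1 scale1r.
by rewrite (sw_one (bilinear_mul S idfun)) /= mulr1.
Qed.

(** Both sides are convolution inverses of the multiplication on [A ⊗ A].
    Currying the first argument keeps the convolution on [A] itself: the
    target is the space of maps [A -> A] under convolution. *)
Lemma antipodeM a b : S (a * b) = S b * S a.
Proof.
pose mu (f g : A -> A) : A -> A := fun x => \sum_(q <- sw x) f q.1 * g q.2.
pose e : A -> A := fun x => eps x *: 1.
pose F a : A -> A := fun b => S (a * b).
pose G a : A -> A := fun b => a * b.
pose P a : A -> A := fun b => S b * S a.
suff FP : F =1 P by have := congr1 (@^~ b) (FP a).
have linF : @GRing.linear_for k A (A -> A) *:%R F.
  by move=> c x y; apply/funext => z; rewrite /F mulrDl -scalerAl linearP.
have linG : @GRing.linear_for k A (A -> A) *:%R G.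
  by move=> c x y; apply/funext => z; rewrite /G mulrDl -scalerAl.
have linP : @GRing.linear_for k A (A -> A) *:%R P.
  by move=> c x y; apply/funext => z; rewrite /P linearP mulrDr -scalerAr.
apply: (@conv_inverse_unique (A -> A) mu e F G P) => //.
- split=> [h c f g|h c f g]; apply/funext => x.
    rewrite -[RHS]/(c *: mu f h x + mu g h x) /mu scaler_sumr -big_split.
    by apply: eq_bigr => p _; rewrite !fctE mulrDl -scalerAl.
  rewrite -[RHS]/(c *: mu h f x + mu h g x) /mu scaler_sumr -big_split.
  by apply: eq_bigr => p _; rewrite !fctE mulrDr -scalerAr.
- move=> x y z; apply/funext => t; rewrite /mu.
  under eq_bigr => p _ do rewrite big_distrr /=.
  rewrite -(sw_assoc (F := fun u v w => F x u * (G y v * P z w))).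
  + apply: eq_bigr => p _; rewrite big_distrl /=.
    by apply: eq_bigr => q _; rewrite mulrA.
  + move=> u; split=> [v c w w'|v c w w'].
      by rewrite /G mulrDr -scalerAr mulrDl mulrDr -scalerAl -scalerAr.
    by rewrite /P linearP mulrDl !mulrDr -scalerAl -!scalerAr.
  + by move=> v w c u u'; rewrite /F mulrDr -scalerAr linearP mulrDl -scalerAl.
- move=> x; apply/funext => t; rewrite /mu /e /F.
  rewrite -{2}(sw_counitr t) mulr_sumr linear_sum; apply: eq_bigr => p _.
  by rewrite -!scalerAr mulr1 linearZ.
- move=> x; apply/funext => t; rewrite /mu /e /P.
  rewrite -{2}(sw_counitl t) linear_sum mulr_suml; apply: eq_bigr => p _.
  by rewrite -scalerAl mul1r linearZ /= -scalerAl.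
- move=> x; apply/funext => t; rewrite fct_sumE /mu /e /F /G.
  rewrite -(sw_mul x t (bilinear_mul S idfun)) /= sw_antipodel counitM.
  by rewrite !fctE scalerA.
- move=> x; apply/funext => t; rewrite fct_sumE /mu /e /G /P.
  transitivity (\sum_(p <- sw x) eps t *: (p.1 * S p.2)).
    apply: eq_bigr => p _.
    under eq_bigr => q _ do rewrite -mulrA [q.1 * _]mulrA.
    by rewrite -mulr_sumr -mulr_suml sw_antipoder -scalerAl mul1r -scalerAr.
  by rewrite -scaler_sumr sw_antipoder !fctE !scalerA mulrC.
Qed.

(** The antipode reverses the coproduct: [coprod o S] and
    [a |-> S(a_(2)) ⊗ S(a_(1))] are both convolution inverses of the coproduct
    in [Hom(A, A ⊗ A)]. *)
Lemma sw_antipode (W : lmodType k) (F : A -> A -> W) a :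
  bilinear_map F ->
  \sum_(p <- sw (S a)) F p.1 p.2 = \sum_(p <- sw a) F (S p.2) (S p.1).
Proof.
move=> bF.
have [tl tr] := tens_bilinear A A.
pose mu : tensor A A -> tensor A A -> tensor A A := tmap2 *%R *%R.
have mu_tens x y u v : mu (x ⊗ y) (u ⊗ v) = (x * u) ⊗ (y * v) :=
  tmap2_tens (mul_bilinear A) (mul_bilinear A) x y u v.
have [lmu rmu] : bilinear_map mu := tmap2_bilinear (mul_bilinear A) (mul_bilinear A).
pose P a : tensor A A := \sum_(p <- sw a) S p.2 ⊗ S p.1.
have bP : @bilinear_map k A A _ (fun x y => S y ⊗ S x).
  by split=> [v c u u'|u c v v']; rewrite /= linearP ?tl ?tr.
suff SP : coprod H (S a) = P a.
  by rewrite -tlift_sw // SP /P -(big_map (fun p => (S p.2, S p.1)) predT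
    (fun p => p.1 ⊗ p.2)) tlift_sum // big_map.
apply: (@conv_inverse_unique _ mu (1 ⊗ 1) (fun x => coprod H (S x)) (coprod H) P).
- by split.
- by move=> c x y; rewrite !linearP.
- exact: linearP.
- exact: sw_linear bP.
- move=> x y z /=; move: (coprod H (S x)) (coprod H y) (P z) => s t r.
  have [s' ->] := tensor_spanned s; have [t' ->] := tensor_spanned t.
  rewrite !(linear_sumE (lmu _)); apply: eq_bigr => p _.
  rewrite !(linear_sumE (rmu _)) (linear_sumE (lmu _)).
  apply: eq_bigr => q _; have [r' ->] := tensor_spanned r.
  rewrite !(linear_sumE (rmu _)).
  by apply: eq_bigr => i _; rewrite !mu_tens !mulrA.
- move=> x /=; move: (coprod H _) => s; have [s' ->] := tensor_spanned s.
  by rewrite (linear_sumE (lmu _)); apply: eq_bigr => p _; rewrite mu_tens !mulr1.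
- move=> x; rewrite /P (linear_sumE (rmu _)).
  by apply: eq_bigr => p _; rewrite mu_tens !mul1r.
- move=> x; under eq_bigr => p _ do rewrite -[mu _ _]coprodM.
  by rewrite -linear_sum sw_antipodel linearZ /= coprod1.
- move=> x.
  transitivity (\sum_(p <- sw x) \sum_(r <- sw p.1) \sum_(q <- sw p.2)
      (r.1 * S q.2) ⊗ (r.2 * S q.1)).
    apply: eq_bigr => p _; rewrite sw_coprod (linear_sumE (lmu _)); apply: eq_bigr => r _.
    by rewrite /P (linear_sumE (rmu _)); apply: eq_bigr => q _; rewrite mu_tens.
  (* a_(1) S(a_(4)) ⊗ a_(2) S(a_(3)): the two inner factors cancel first. *)
  have bQ u v : bilinear_map (fun x y => (u * S y) ⊗ (v * S x)).
    split=> [y c w w'|y c w w']; rewrite /= linearP mulrDr -scalerAr.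
      by rewrite tr.
    by rewrite tl.
  rewrite (sw_assoc (F := fun u v z => \sum_(q <- sw z) (u * S q.2) ⊗ (v * S q.1))).
  + transitivity (\sum_(p <- sw x) (p.1 * S p.2) ⊗ (1 : A)).
      apply: eq_bigr => p _.
      rewrite -(sw_assoc (F := fun u v z => (p.1 * S z) ⊗ (u * S v))).
      * rewrite -{2}(sw_counitl p.2) linear_sum mulr_sumr /=.
        rewrite (linear_sumE (tl _)); apply: eq_bigr => q _.
        rewrite -(linear_sumE (tr _)) sw_antipoder (linear_scaleE (tr _)).
        by rewrite linearZ /= -scalerAr (linear_scaleE (tl _)).
      * move=> u; split=> [v c z z'|v c z z'].
          by rewrite /= linearP mulrDr -scalerAr tr.
        by rewrite /= linearP mulrDr -scalerAr tl.
      * by move=> u v c z z'; rewrite mulrDl -scalerAl tr.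
    by rewrite -(linear_sumE (tl 1)) sw_antipoder (linear_scaleE (tl _)).
  + move=> u; split=> [z c v v'|v]; last exact: sw_linear (bQ u v).
    rewrite scaler_sumr -big_split; apply: eq_bigr => p _ /=.
    by rewrite mulrDl -scalerAl tr.
  + move=> u v c z z'; rewrite scaler_sumr -big_split; apply: eq_bigr => p _ /=.
    by rewrite mulrDl -scalerAl tl.
Qed.

End Sweedler.

(** * Functionals acting on a Hopf algebra *)

Section HopfActions.
Variables (k : fieldType) (A : algType k) (H : hopf_algebra A).
Local Notation S := (antipode H).
Local Notation eps := (counit H).
Local Notation sw := (sw H).

Lemma counit_antipode a : eps (S a) = eps a.
Proof.
rewrite -{1}(sw_counitr H a) linear_sum.
transitivity (eps (\sum_(p <- sw a) S p.1 * p.2)); last first.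
  by rewrite sw_antipodel linearZ /= counit1; apply: mulr1.
rewrite !linear_sum; apply: eq_bigr => p _.
by rewrite !linearZ /= counitM mulrC.
Qed.

Lemma hactE (g : {linear A -> k^o}) a :
  hact H g a = \sum_(p <- sw a) g p.2 *: p.1.
Proof. exact: tlift_sw (bilinear_evalr g). Qed.

Lemma hact_linear (g : {linear A -> k^o}) : linear (hact H g).
Proof. by move=> c x y; rewrite !hactE; apply: sw_linear (bilinear_evalr g) _ _ _. Qed.

Lemma counit_hact (g : {linear A -> k^o}) a : eps (hact H g a) = g a.
Proof.
rewrite hactE linear_sum -{2}(sw_counitl H a) linear_sum.
by apply: eq_bigr => p _; rewrite !linearZ /=; apply: mulrC.
Qed.

Lemma hact1 (g : {linear A -> k^o}) : hact H g 1 = g 1 *: 1.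
Proof. by rewrite hactE (sw_one H (bilinear_evalr g)). Qed.

Definition conv (u v : A -> k) (a : A) : k := \sum_(p <- sw a) u p.1 * v p.2.

(** The action turns convolution of functionals into composition of operators,
    so identities between operators reduce to identities in the convolution
    algebra. *)
Lemma hact_hact (u v : {linear A -> k^o}) a :
  hact H u (hact H v a) = \sum_(p <- sw a) conv u v p.2 *: p.1.
Proof.
rewrite (hactE v) (linear_sumE (hact_linear u)).
transitivity (\sum_(p <- sw a) \sum_(q <- sw p.1) (u q.2 * v p.2 : k) *: q.1).
  apply: eq_bigr => p _; rewrite (linear_scaleE (hact_linear u)) hactE scaler_sumr.
  by apply: eq_bigr => q _; rewrite scalerA mulrC.
rewrite (sw_assoc H (F := fun x y z => (u y * v z : k) *: x)).
- by apply: eq_bigr => p _; rewrite scaler_suml.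
- move=> x; split=> [y c z z'|y c z z'] /=.
    rewrite linearP mulrDl scalerDl -[c *: u z]/(c * u z) -mulrA.
    by rewrite scalerA.
  rewrite linearP mulrDr scalerDl -[c *: v z]/(c * v z) mulrCA.
  by rewrite scalerA.
- by move=> y z c x x'; rewrite scalerDr !scalerA [_ * c]mulrC.
Qed.

Lemma sum_hact_hact (I : finType) (u v : I -> {linear A -> k^o}) a :
  \sum_i hact H (u i) (hact H (v i) a) =
  \sum_(p <- sw a) (\sum_i conv (u i) (v i) p.2) *: p.1.
Proof.
under eq_bigr do rewrite hact_hact.
by rewrite exchange_big; apply: eq_bigr => p _; rewrite scaler_suml.
Qed.

Lemma hact_inverse (I : finType) (u v : I -> {linear A -> k^o}) c a :
  (forall b, \sum_i conv (u i) (v i) b = eps b * c) ->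
  \sum_i hact H (u i) (hact H (v i) a) = c *: a.
Proof.
move=> uv; rewrite sum_hact_hact -[in RHS](sw_counitr H a) scaler_sumr.
by apply: eq_bigr => p _; rewrite uv scalerA mulrC.
Qed.

(** Since the coproduct is multiplicative, a Leibniz rule for functionals lifts
    to the operators they induce; the counit lifts to the identity. *)
Lemma hact_twisted_derivation (I : finType) (u : {linear A -> k^o})
    (v w : I -> {linear A -> k^o}) :
  (forall a b : A, u (a * b) = \sum_i v i a * w i b + eps a * u b) ->
  forall a b : A, hact H u (a * b) =
    \sum_i hact H (v i) a * hact H (w i) b + a * hact H u b.
Proof.
move=> uM a b; rewrite hactE (sw_mul H _ _ (bilinear_evalr u)).
transitivity (\sum_(p <- sw a) \sum_(q <- sw b)
    (\sum_i (v i p.2 *: p.1) * (w i q.2 *: q.1)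
     + (eps p.2 *: p.1) * (u q.2 *: q.1))).
  apply: eq_bigr => p _; apply: eq_bigr => q _; rewrite uM scalerDl scaler_suml.
  congr (_ + _); last by rewrite -scalerAl -scalerAr scalerA.
  by apply: eq_bigr => i _; rewrite -scalerAl -scalerAr scalerA.
under eq_bigr do rewrite big_split.
rewrite big_split; congr (_ + _); last first.
  rewrite -[in RHS](sw_counitr H a) mulr_suml; apply: eq_bigr => p _.
  by rewrite hactE mulr_sumr.
under eq_bigr do rewrite exchange_big.
rewrite exchange_big; apply: eq_bigr => i _.
by rewrite !hactE mulr_suml; apply: eq_bigr => p _; rewrite mulr_sumr.
Qed.

Section InverseAntipode.
Variable Sinv : {linear A -> A}.
Hypotheses (SK : cancel S Sinv) (SinvK : cancel Sinv S).

Lemma SinvM a b : Sinv (a * b) = Sinv b * Sinv a.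
Proof. by apply: (can_inj SK); rewrite antipodeM !SinvK. Qed.

Lemma Sinv1 : Sinv 1 = 1.
Proof. by rewrite -{1}(antipode1 H) SK. Qed.

Lemma counit_Sinv a : eps (Sinv a) = eps a.
Proof. by rewrite -{2}(SinvK a) counit_antipode. Qed.

Lemma sw_Sinv (W : lmodType k) (F : A -> A -> W) a :
  bilinear_map F ->
  \sum_(p <- sw (Sinv a)) F p.1 p.2 = \sum_(p <- sw a) F (Sinv p.2) (Sinv p.1).
Proof.
move=> bF; pose G x y := F (Sinv y) (Sinv x).
have bG : bilinear_map G := bilinear_map_swap (bilinear_map_comp Sinv Sinv bF).
rewrite -{2}(SinvK a) (sw_antipode H _ bG) /G.
by apply: eq_bigr => p _; rewrite !SK.
Qed.

Lemma sw_Sinv2 (W : lmodType k) (F : A -> A -> W) a :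
  bilinear_map F ->
  \sum_(p <- sw (Sinv (Sinv a))) F p.1 p.2 =
  \sum_(p <- sw a) F (Sinv (Sinv p.1)) (Sinv (Sinv p.2)).
Proof.
move=> bF; rewrite (sw_Sinv _ bF).
exact: (sw_Sinv _ (bilinear_map_swap (bilinear_map_comp Sinv Sinv bF))).
Qed.

(** The inverse antipode satisfies the antipode identities for the reversed
    coproduct: apply [S], which is antimultiplicative. *)
Lemma sw_Sinvl a : \sum_(p <- sw a) Sinv p.2 * p.1 = eps a *: 1.
Proof.
apply: (can_inj SK); rewrite linear_sum linearZ /= antipode1 -sw_antipodel.
by apply: eq_bigr => p _; rewrite antipodeM SinvK.
Qed.

Lemma sw_Sinvr a : \sum_(p <- sw a) p.2 * Sinv p.1 = eps a *: 1.
Proof.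
apply: (can_inj SK); rewrite linear_sum linearZ /= antipode1 -sw_antipoder.
by apply: eq_bigr => p _; rewrite antipodeM SinvK.
Qed.

(** [S^2] is a coalgebra automorphism, so conjugating by it the operator induced
    by [g] gives the operator induced by [g o S^-2]. *)
Lemma antipode2_hact (g : {linear A -> k^o}) a :
  S (S (hact H g (Sinv (Sinv a)))) = hact H (g \o (Sinv \o Sinv)) a.
Proof.
rewrite !hactE (sw_Sinv2 _ (bilinear_evalr g)) !linear_sum.
by apply: eq_bigr => p _; rewrite !linearZ /= !SinvK.
Qed.

Section TwistedDerivations.
Variables (n : nat) (f : 'I_n -> 'I_n -> {linear A -> k^o}).
Variable (chi : 'I_n -> {linear A -> k^o}).
Hypothesis f1 : forall i j, f i j 1 = (i == j)%:R.
Hypothesis fM : forall i j (a b : A), f i j (a * b) = \sum_l f i l a * f l j b.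
Hypothesis chiM : forall j (a b : A),
  chi j (a * b) = \sum_i chi i a * f i j b + eps a * chi j b.

(** The matrix inverses of [f] below all come from this collapse: it moves a
    convolution of entries of [f] inside [f], where the arguments multiply to
    [eps(a) 1]. *)
Lemma sum_f_mul (I : Type) (s : seq I) (F G : I -> A) i j :
  \sum_l \sum_(p <- s) f i l (F p) * f l j (G p) =
  f i j (\sum_(p <- s) F p * G p).
Proof.
by rewrite exchange_big linear_sum; apply: eq_bigr => p _; rewrite fM.
Qed.

Lemma f_scale1 i j c : f i j (c *: 1) = c * (i == j)%:R.
Proof. by rewrite linearZ /= f1. Qed.

Lemma twisted_derivation1 j : chi j 1 = 0.
Proof.
have := chiM j 1 1; rewrite mulr1 counit1 mul1r (bigD1 j) //= f1 eqxx mulr1.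
rewrite big1 ?addr0 => [/eqP|i ij]; last by rewrite f1 (negPf ij) mulr0.
by rewrite -subr_eq0 opprD addrA subrr sub0r oppr_eq0 => /eqP.
Qed.

Lemma conv_f_Sinv i j a :
  \sum_l conv (f l j \o Sinv) (f i l) a = eps a * (i == j)%:R.
Proof.
rewrite -f_scale1 -sw_Sinvr -sum_f_mul; apply: eq_bigr => l _.
by apply: eq_bigr => p _; apply: mulrC.
Qed.

Lemma conv_f_Sinv2l i j a :
  \sum_l conv (f i l \o (Sinv \o Sinv)) (f l j \o Sinv) a = eps a * (i == j)%:R.
Proof.
rewrite sum_f_mul -f_scale1; congr (f i j _).
transitivity (Sinv (\sum_(p <- sw a) p.2 * Sinv p.1)).
  by rewrite linear_sum; apply: eq_bigr => p _; rewrite SinvM.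
by rewrite sw_Sinvr linearZ /= Sinv1.
Qed.

Lemma conv_f_Sinv2r i j a :
  \sum_l conv (f i l \o Sinv) (f l j \o (Sinv \o Sinv)) a = eps a * (i == j)%:R.
Proof.
rewrite sum_f_mul -f_scale1; congr (f i j _).
transitivity (Sinv (\sum_(p <- sw a) Sinv p.2 * p.1)).
  by rewrite linear_sum; apply: eq_bigr => p _; rewrite SinvM.
by rewrite sw_Sinvl linearZ /= Sinv1.
Qed.

(** Both sides equal [- chi_j o S^-1]. On the left,
    [0 = eps(a) chi_j(1) = chi_j(S^-2(a_(1)) S^-1(a_(2)))] expands by the twisted
    Leibniz rule; on the right, so does [0 = chi_j(a_(2) S^-1(a_(1)))]. *)
Lemma conv_chi_f j a :
  \sum_i conv (chi i \o (Sinv \o Sinv)) (f i j \o Sinv) a =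
  \sum_i conv (f i j \o Sinv) (chi i) a.
Proof.
transitivity (- chi j (Sinv a)).
  transitivity (chi j (\sum_(p <- sw a) Sinv (Sinv p.1) * Sinv p.2) -
    chi j (\sum_(p <- sw a) eps p.1 *: Sinv p.2)).
    rewrite /conv exchange_big -linearB -sumrB linear_sum; apply: eq_bigr => p _.
    by rewrite linearB linearZ chiM !counit_Sinv /= addrK.
  have -> : \sum_(p <- sw a) Sinv (Sinv p.1) * Sinv p.2 = eps a *: 1.
    transitivity (Sinv (\sum_(p <- sw a) p.2 * Sinv p.1)).
      by rewrite linear_sum; apply: eq_bigr => p _; rewrite SinvM.
    by rewrite sw_Sinvr linearZ /= Sinv1.
  rewrite linearZ /= twisted_derivation1 scaler0 sub0r; congr (- chi j _).
  rewrite -[in RHS](sw_counitl H a) linear_sum.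
  by apply: eq_bigr => p _; rewrite linearZ.
transitivity (chi j (\sum_(p <- sw a) p.2 * Sinv p.1) -
  chi j (\sum_(p <- sw a) eps p.2 *: Sinv p.1)).
  rewrite sw_Sinvr linearZ /= twisted_derivation1 scaler0 sub0r; congr (- chi j _).
  rewrite -[in LHS](sw_counitr H a) linear_sum.
  by apply: eq_bigr => p _; rewrite linearZ.
rewrite /conv exchange_big -linearB -sumrB linear_sum; apply: eq_bigr => p _.
rewrite linearB linearZ chiM /= addrK; apply: eq_bigr => i _; exact: mulrC.
Qed.

Lemma chi_Sinv2M j (a b : A) : (chi j \o (Sinv \o Sinv)) (a * b) =
  \sum_i (chi i \o (Sinv \o Sinv)) a * (f i j \o (Sinv \o Sinv)) b
  + eps a * (chi j \o (Sinv \o Sinv)) b.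
Proof. by rewrite /= !SinvM chiM !counit_Sinv. Qed.

End TwistedDerivations.
End InverseAntipode.
End HopfActions.

Lemma left_mod_map_linear (k : fieldType) (A : algType k) (M : bimodule A)
    (L : M -> A) : left_mod_map L -> linear L.
Proof.
move=> [LD LM] c x y; rewrite LD; congr (_ + _).
have -> : c *: x = lact c%:A x.
  by rewrite (linear_scaleE (lact_linearl x)) lact1.
by rewrite LM -scalerAl mul1r.
Qed.

Lemma rhom_linear (k : fieldType) (A : algType k) (M : bimodule A)
    (L : rhom M) : linear L.
Proof. by move=> c x y; rewrite rhomD rhomZ. Qed.

(** * Coefficients of a left covariant calculus *)

Section CovariantCalculus.
Variables (k : fieldType) (A : algType k) (H : hopf_algebra A).
Variables (Om : fodc A) (DL : {linear Om -> tensor A Om}).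
Hypothesis hDL : left_coaction H DL.
Local Notation S := (antipode H).
Local Notation eps := (counit H).
Local Notation sw := (sw H).
Local Notation d := (fodc_d Om).

Lemma lact_d_bilinear : bilinear_map (fun a b => lact a (d b)).
Proof. exact: (bilinear_map_comp idfun d (lact_bilinear Om)). Qed.

Lemma coaction_lact_d a b :
  DL (lact a (d b)) =
  \sum_(p <- sw a) \sum_(q <- sw b) (p.1 * q.1) ⊗ lact p.2 (d q.2).
Proof.
rewrite hDL -[LHS]/(tmap2 *%R (fun a b => lact a (d b)) (coprod H a) (coprod H b)).
by rewrite !sw_coprod (tmap2_sum (mul_bilinear A) lact_d_bilinear).
Qed.

Lemma coaction_lact a x : DL (lact a x) = tmap2 *%R (@lact _ _ Om) (coprod H a) (DL x).
Proof.
have [tl tr] := tmap2_bilinear (mul_bilinear A) (lact_bilinear Om).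
have [s ->] := fodc_span x.
rewrite (linear_sumE (lact_linearr a)) !linear_sum (linear_sumE (tr _)).
apply: eq_bigr => -[b c] _ /=; rewrite -lactM !coaction_lact_d sw_coprod.
rewrite (linear_sumE (tl _)).
have [ttl ttr] := tens_bilinear A Om.
have bF (r : A * A) : @bilinear_map k A A _
    (fun x y => (x * r.1) ⊗ lact y (d r.2)).
  split=> [v e y z|u e y z]; first by rewrite /= mulrDl -scalerAl ttl.
  by rewrite lact_linearl ttr.
have bF' : @bilinear_map k A A _ (fun x y =>
    \sum_(r <- sw c) (x * r.1) ⊗ lact y (d r.2)).
  by split=> [v|u]; apply: linear_bigsum => r; case: (bF r) => bl br.
rewrite (sw_mul H a b bF'); apply: eq_bigr => p _.
rewrite (linear_sumE (tr _)); apply: eq_bigr => q _.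
rewrite (linear_sumE (tr _)); apply: eq_bigr => r _.
by rewrite (tmap2_tens (mul_bilinear A) (lact_bilinear Om)) mulrA lactM.
Qed.

Lemma coaction_d a : DL (d a) = \sum_(p <- sw a) p.1 ⊗ d p.2.
Proof.
rewrite -[d a]lact1 hDL coprod1.
rewrite -[LHS]/(tmap2 *%R (fun a b => lact a (d b)) (1 ⊗ 1) (coprod H a)).
rewrite sw_coprod; have := tmap2_sum (mul_bilinear A) lact_d_bilinear [:: (1, 1)] (sw a).
by rewrite !big_seq1 => ->; apply: eq_bigr => p _; rewrite /= mul1r lact1.
Qed.

(** The coaction is prescribed on [a d(b)] only; right multiplication is reached
    through [d(c) a = d(ca) - c d(a)]. *)
Lemma coaction_ract x a : DL (ract x a) = tmap2 *%R (@ract _ _ Om) (DL x) (coprod H a).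
Proof.
have bt := tmap2_bilinear (mul_bilinear A) (ract_bilinear Om).
have [tl tr] := bt.
have btl := tmap2_bilinear (mul_bilinear A) (lact_bilinear Om).
have [s ->] := fodc_span x.
rewrite (linear_sumE (ract_linearl a)) !linear_sum (linear_sumE (tl _)).
apply: eq_bigr => -[b c] _ /=; rewrite lractA !coaction_lact.
have -> : ract (d c) a = d (c * a) - lact c (d a) by rewrite fodc_leibniz addrK.
rewrite linearB coaction_lact_d !coaction_d.
have bF : @bilinear_map k A A _ (fun x y => x ⊗ d y).
  have [ttl ttr] := tens_bilinear A Om.
  by split=> [v e y z|u e y z]; rewrite /= ?linearP ?ttl ?ttr.
rewrite (sw_mul H c a bF) !sw_coprod.
rewrite -sumrB.
transitivity (tmap2 *%R (@lact _ _ Om) (\sum_(p <- sw b) p.1 ⊗ p.2)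
   (\sum_(p <- sw c) \sum_(q <- sw a) (p.1 * q.1) ⊗ ract (d p.2) q.2)).
  congr (tmap2 _ _ _ _); apply: eq_bigr => p _; rewrite -sumrB.
  apply: eq_bigr => q _ /=.
  have addt u v w : u ⊗ (v + w) = u ⊗ v + u ⊗ w :> tensor A Om.
    by have := (tens_bilinear A Om).2 u 1 v w; rewrite !scale1r.
  by rewrite fodc_leibniz addt addrK.
rewrite !(linear_sumE (btl.1 _)) (linear_sumE (tl _)); apply: eq_bigr => p _.
rewrite !(linear_sumE (btl.2 _)) (linear_sumE (tl _)); apply: eq_bigr => q _.
rewrite (linear_sumE (btl.2 _)) (tmap2_tens (mul_bilinear A) (lact_bilinear Om)).
rewrite (linear_sumE (tr _)); apply: eq_bigr => r _.
rewrite (tmap2_tens (mul_bilinear A) (lact_bilinear Om)).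
rewrite (tmap2_tens (mul_bilinear A) (ract_bilinear Om)).
by rewrite mulrA lractA.
Qed.


(** The map [(id ⊗ eps o L)] on [A ⊗ Omega^1]. Following the coaction it
    reconstructs [L] when [L] is a dual basis element, which is how covariance
    reduces [L] to its composite with the counit. *)
Definition coefficient (L : Om -> A) (t : tensor A Om) : A :=
  tlift (fun a x => (eps (L x) : k) *: a) t.

Lemma coefficient_bilinear (L : Om -> A) :
  linear L -> bilinear_map (fun (a : A) x => (eps (L x) : k) *: a).
Proof.
move=> linL; split=> [v c x y|u c x y] /=.
  by rewrite scalerDr !scalerA mulrC.
by rewrite linL linearP scalerDl scalerA.
Qed.

Lemma coefficient_linear (L : Om -> A) : linear L -> linear (coefficient L).
Proof. by move=> /coefficient_bilinear[bl br]; apply: tlift_linear. Qed.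

Lemma coefficient_tens (L : Om -> A) a x :
  linear L -> coefficient L (a ⊗ x) = eps (L x) *: a.
Proof. by move=> /coefficient_bilinear[bl br]; rewrite /coefficient tlift_tens. Qed.

Variables (n : nat) (w : 'I_n -> Om) (hw : left_invariant_basis DL w).

Lemma coaction_lact_basis a i : DL (lact a (w i)) = \sum_(p <- sw a) p.1 ⊗ lact p.2 (w i).
Proof.
have [DLw _ _] := hw; rewrite coaction_lact DLw sw_coprod.
have := tmap2_sum (mul_bilinear A) (lact_bilinear Om) (sw a) [:: (1, w i)].
rewrite big_seq1 => ->; apply: eq_bigr => p _.
by rewrite big_seq1 mulr1.
Qed.

Lemma coaction_ract_basis a i : DL (ract (w i) a) = \sum_(p <- sw a) p.1 ⊗ ract (w i) p.2.
Proof.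
have [DLw _ _] := hw; rewrite coaction_ract DLw sw_coprod.
have := tmap2_sum (mul_bilinear A) (ract_bilinear Om) [:: (1, w i)] (sw a).
by rewrite !big_seq1 => ->; apply: eq_bigr => p _; rewrite mul1r.
Qed.

(** On [b w_i], invariance of [w_i] gives [b_(1) eps(b_(2) L(w_i))]; since
    [L(w_i)] is a scalar the counit law returns [b L(w_i)]. *)
Lemma coefficient_coaction_left (L : Om -> A) (c : 'I_n -> k) :
  left_mod_map L -> (forall i, L (w i) = c i *: 1) ->
  forall x, coefficient L (DL x) = L x.
Proof.
move=> LP Lw x; have linL := left_mod_map_linear LP.
have [_ lb _] := hw; have [b [-> _]] := lb x.
rewrite linear_sum (linear_sumE (coefficient_linear linL)) (linear_sumE linL).
apply: eq_bigr => i _; rewrite coaction_lact_basis LP.2 Lw -scalerAr mulr1.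
rewrite (linear_sumE (coefficient_linear linL)) -[in RHS](sw_counitr H (b i)).
rewrite scaler_sumr; apply: eq_bigr => p _.
rewrite coefficient_tens // LP.2 Lw -scalerAr mulr1 linearZ scalerA; congr (_ *: _).
Qed.

Lemma coefficient_coaction_right (L : rhom Om) (c : 'I_n -> k) :
  (forall i, L (w i) = c i *: 1) -> forall x, coefficient L (DL x) = L x.
Proof.
move=> Lw x; have linL := rhom_linear L.
have [_ _ rb] := hw; have [b [-> _]] := rb x.
rewrite linear_sum (linear_sumE (coefficient_linear linL)) (linear_sumE linL).
apply: eq_bigr => i _; rewrite coaction_ract_basis rhomM Lw -scalerAl mul1r.
rewrite (linear_sumE (coefficient_linear linL)) -[in RHS](sw_counitr H (b i)).
rewrite scaler_sumr; apply: eq_bigr => p _.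
by rewrite coefficient_tens // rhomM Lw -scalerAl mul1r linearZ scalerA.
Qed.

Variables (xi : 'I_n -> rhom Om) (lam : 'I_n -> Om -> A).
Hypothesis hxi : forall i j, xi i (w j) = (i == j)%:R.
Hypothesis hlam : forall i, left_mod_map (lam i).
Hypothesis hlamw : forall i j, lam i (w j) = (i == j)%:R.

Let lam_linear i : linear (lam i) := left_mod_map_linear (hlam i).

Lemma left_expansion x : x = \sum_i lact (lam i x) (w i).
Proof.
have [_ lb _] := hw; have [b [xE _]] := lb x.
rewrite {1}xE; apply: eq_bigr => i _; congr (lact _ _).
rewrite xE (linear_sumE (lam_linear i)) (bigD1 i) //= big1 => [|j ji].
  by rewrite addr0 (hlam i).2 hlamw eqxx mulr1.
by rewrite (hlam i).2 hlamw eq_sym (negPf ji) mulr0.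
Qed.

Lemma right_expansion x : x = \sum_i ract (w i) (xi i x).
Proof.
have [_ _ rb] := hw; have [b [xE _]] := rb x.
rewrite {1}xE; apply: eq_bigr => i _; congr (ract _ _).
rewrite xE (linear_sumE (rhom_linear (xi i))) (bigD1 i) //= big1 => [|j ji].
  by rewrite addr0 rhomM hxi eqxx mul1r.
by rewrite rhomM hxi eq_sym (negPf ji) mul0r.
Qed.

(** The functionals that encode the calculus: [tangent] for the differential,
    [twist] and [cotwist] for moving an element of [A] across the basis from
    right to left and from left to right. *)
Fact tangent_linear i : linear (fun a => eps (lam i (d a)) : k^o).
Proof. by move=> c a b; rewrite linearP lam_linear linearP. Qed.
Definition tangent i : {linear A -> k^o} := mk_linear (tangent_linear i).

Fact twist_linear i j : linear (fun a => eps (lam j (ract (w i) a)) : k^o).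
Proof. by move=> c a b; rewrite ract_linearr lam_linear linearP. Qed.
Definition twist i j : {linear A -> k^o} := mk_linear (twist_linear i j).

Fact cotwist_linear i j : linear (fun a => eps (xi j (lact a (w i))) : k^o).
Proof. by move=> c a b; rewrite lact_linearl rhom_linear linearP. Qed.
Definition cotwist i j : {linear A -> k^o} := mk_linear (cotwist_linear i j).

Lemma lam_coaction i x : coefficient (lam i) (DL x) = lam i x.
Proof.
apply: (coefficient_coaction_left (c := fun j => (i == j)%:R)) => // j.
by rewrite hlamw scaler_nat.
Qed.

Lemma xi_coaction i x : coefficient (xi i) (DL x) = xi i x.
Proof.
apply: (coefficient_coaction_right (c := fun j => (i == j)%:R)) => // j.
by rewrite hxi scaler_nat.
Qed.

Lemma lam_d i a : lam i (d a) = hact H (tangent i) a.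
Proof.
rewrite -lam_coaction coaction_d (linear_sumE (coefficient_linear (lam_linear i))).
by rewrite hactE; apply: eq_bigr => p _; rewrite coefficient_tens.
Qed.

Lemma lam_ract i j a : lam j (ract (w i) a) = hact H (twist i j) a.
Proof.
rewrite -lam_coaction coaction_ract_basis.
rewrite (linear_sumE (coefficient_linear (lam_linear j))).
by rewrite hactE; apply: eq_bigr => p _; rewrite coefficient_tens.
Qed.

Lemma xi_lact i j a : xi j (lact a (w i)) = hact H (cotwist i j) a.
Proof.
rewrite -xi_coaction coaction_lact_basis.
rewrite (linear_sumE (coefficient_linear (rhom_linear (xi j)))).
rewrite hactE; apply: eq_bigr => p _; rewrite coefficient_tens //.
exact: rhom_linear.
Qed.

Lemma twist1 i j : twist i j 1 = (i == j)%:R.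
Proof.
rewrite /= ract1 hlamw eq_sym; case: (i == j); first exact: counit1.
exact: linear0.
Qed.

Lemma lam_ract_expand j x a :
  lam j (ract x a) = \sum_i lam i x * lam j (ract (w i) a).
Proof.
rewrite {1}(left_expansion x) (linear_sumE (ract_linearl a)).
rewrite (linear_sumE (lam_linear j)); apply: eq_bigr => i _.
by rewrite lractA (hlam j).2.
Qed.

Lemma twistM i j (a b : A) : twist i j (a * b) = \sum_l twist i l a * twist l j b.
Proof.
rewrite /= ractM lam_ract_expand linear_sum; apply: eq_bigr => l _.
exact: (counitM H).
Qed.

Lemma tangentM j (a b : A) :
  tangent j (a * b) = \sum_i tangent i a * twist i j b + eps a * tangent j b.
Proof.
rewrite /= fodc_leibniz (hlam j).1 lam_ract_expand (hlam j).2 linearD linear_sum.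
by congr (_ + _); [apply: eq_bigr => i _|]; apply: (counitM H).
Qed.

Variable Sinv : {linear A -> A}.
Hypotheses (SK : cancel S Sinv) (SinvK : cancel Sinv S).

(** Moving [a] to the right of [w_i] and back to the left changes nothing. *)
Lemma conv_twist_cotwist i l a :
  \sum_j conv H (twist j l) (cotwist i j) a = eps a * (i == l)%:R.
Proof.
transitivity (eps (lam l (\sum_j ract (w j) (xi j (lact a (w i)))))).
  rewrite (linear_sumE (lam_linear l)) linear_sum; apply: eq_bigr => j _.
  rewrite lam_ract counit_hact xi_lact hactE linear_sum.
  by apply: eq_bigr => p _; rewrite linearZ; apply: mulrC.
rewrite -right_expansion (hlam l).2 hlamw counitM eq_sym.
by case: (i == l); rewrite /= ?counit1 ?linear0.
Qed.

(** Both sides, with their indices transposed, are convolution inverses of the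
    transpose of [twist], in the algebra of matrix-valued maps. *)
Lemma cotwistE i j a : cotwist i j a = twist i j (Sinv a).
Proof.
pose P a : 'M[k]_n := \matrix_(j, i) cotwist i j a.
pose G a : 'M[k]_n := \matrix_(l, j) twist j l a.
pose F a : 'M[k]_n := \matrix_(l, j) twist j l (Sinv a).
suff /(_ a)/matrixP/(_ j i) : F =1 P by rewrite !mxE.
apply: (@conv_inverse_unique _ _ H _ (fun X Y => X *m Y) 1%:M F G P).
- split=> [Y c X X'|X c Y Y']; first by rewrite mulmxDl scalemxAl.
  by rewrite mulmxDr scalemxAr.
- by move=> c x y; apply/matrixP=> s t; rewrite !mxE !linearP.
- by move=> c x y; apply/matrixP=> s t; rewrite !mxE !linearP.
- by move=> c x y; apply/matrixP=> s t; rewrite !mxE !linearP.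
- by move=> x y z; rewrite mulmxA.
- by move=> x; rewrite mulmx1.
- by move=> x; rewrite mul1mx.
- move=> x; apply/matrixP=> s t; rewrite summxE !mxE eq_sym.
  rewrite -(conv_f_Sinv SK SinvK twist1 twistM) /conv exchange_big.
  apply: eq_bigr => p _; rewrite !mxE; apply: eq_bigr => l _.
  by rewrite !mxE.
- move=> x; apply/matrixP=> s t; rewrite summxE !mxE eq_sym.
  rewrite -conv_twist_cotwist /conv exchange_big.
  apply: eq_bigr => p _; rewrite !mxE; apply: eq_bigr => l _.
  by rewrite !mxE.
Qed.

Lemma xi_lactE i j a : xi j (lact a (w i)) = hact H (twist i j \o Sinv) a.
Proof.
by rewrite xi_lact !hactE; apply: eq_bigr => p _; rewrite cotwistE.
Qed.

(** * The hom-connection *)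

Local Notation shift g := (g \o (Sinv \o Sinv)).

Definition nabla_sum (f : rhom Om) : A := \sum_i hact H (shift (tangent i)) (f (w i)).

Lemma rhom_lact_basis (f : rhom Om) a i :
  f (lact a (w i)) = \sum_j f (w j) * hact H (twist i j \o Sinv) a.
Proof.
rewrite {1}(right_expansion (lact a (w i))) (linear_sumE (rhom_linear f)).
by apply: eq_bigr => j _; rewrite rhomM xi_lactE.
Qed.

(** The derivation rule of [chi_i o S^-2] applied to
    [f(a w_i) = sum_j f(w_j) t_ij(a)] produces two double sums. In the first,
    the operators acting on [a] compose to the identity matrix; in the second,
    they can be reordered into [sum_i t_ij(l_i(d a)) = xi_j(d a)]. *)
Lemma nabla_sum_leibniz f a :
  nabla_sum (rhom_ract f a) = nabla_sum f * a + f (d a).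
Proof.
rewrite /nabla_sum.
transitivity (\sum_i \sum_j (\sum_m hact H (shift (tangent m)) (f (w j)) *
     hact H (shift (twist m i)) (hact H (twist i j \o Sinv) a)
   + f (w j) * hact H (shift (tangent i)) (hact H (twist i j \o Sinv) a))).
  apply: eq_bigr => i _; rewrite -[rhom_ract f a _]/(f (lact a (w i))).
  rewrite rhom_lact_basis (linear_sumE (hact_linear _ _)); apply: eq_bigr => j _.
  exact: (hact_twisted_derivation (H := H) (u := shift (tangent i))
    (v := fun m => shift (tangent m)) (w := fun m => shift (twist m i))
    (chi_Sinv2M SK SinvK tangentM i)).
under eq_bigr do rewrite big_split.
rewrite big_split; congr (_ + _).
  transitivity (\sum_j \sum_m hact H (shift (tangent m)) (f (w j)) * ((m == j)%:R *: a)).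
    rewrite exchange_big; apply: eq_bigr => j _; rewrite exchange_big.
    apply: eq_bigr => m _; rewrite -mulr_sumr; congr (_ * _).
    apply: hact_inverse => b.
    exact: (conv_f_Sinv2l SK SinvK twist1 twistM).
  rewrite mulr_suml; apply: eq_bigr => j _; rewrite (bigD1 j) //= big1.
    by rewrite addr0 eqxx scale1r.
  by move=> m mj; rewrite (negPf mj) scale0r mulr0.
rewrite exchange_big.
transitivity (\sum_j f (w j) * xi j (d a)).
  apply: eq_bigr => j _; rewrite -mulr_sumr; congr (_ * _).
  rewrite sum_hact_hact.
  under eq_bigr => p _ do rewrite (conv_chi_f SK SinvK twist1 tangentM).
  rewrite -sum_hact_hact {1}(left_expansion (d a)).
  rewrite (linear_sumE (rhom_linear (xi j))); apply: eq_bigr => i _.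
  by rewrite xi_lactE lam_d.
rewrite [in RHS](right_expansion (d a)) (linear_sumE (rhom_linear f)).
by apply: eq_bigr => j _; rewrite rhomM.
Qed.

Lemma nabla_sum_linear : linear nabla_sum.
Proof.
move=> c f g; rewrite /nabla_sum scaler_sumr -big_split; apply: eq_bigr => i _.
exact: hact_linear.
Qed.

Definition covariant_hom_connection : hom_connection Om :=
  @HomConnection _ _ Om (mk_linear nabla_sum_linear) nabla_sum_leibniz.

(** The coefficients are forced by evaluation at the basis: one needs
    [f(w_i) = sum_j t_ij(a_j)], so [a_j] is given by the right inverse of the
    operator matrix [t], whose functionals are [twist] after [S^-2]. *)
Lemma rhom_generated (f : rhom Om) : exists a : 'I_n -> A,
  f = \sum_j rhom_ract (xi j) (a j).
Proof.
exists (fun j => \sum_m hact H (shift (twist j m)) (f (w m))).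
apply: rhom_ext => x.
have sumE (g : 'I_n -> rhom Om) y : (\sum_j g j : rhom Om) y = \sum_j g j y.
  exact: (linear_sumE (f := fun g : rhom Om => g y)).
have eqw i : f (w i) = (\sum_j rhom_ract (xi j)
     (\sum_m hact H (shift (twist j m)) (f (w m))) : rhom Om) (w i).
  rewrite sumE; transitivity (\sum_m (i == m)%:R *: f (w m)).
    rewrite (bigD1 i) //= big1 => [|m mi]; last by rewrite eq_sym (negPf mi) scale0r.
    by rewrite addr0 eqxx scale1r.
  transitivity (\sum_m \sum_j hact H (twist i j \o Sinv)
      (hact H (shift (twist j m)) (f (w m)))).
    apply: eq_bigr => m _; apply/esym/hact_inverse => b.
    exact: (conv_f_Sinv2r SK SinvK twist1 twistM).
  rewrite exchange_big; apply: eq_bigr => j _.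
  rewrite -[rhom_ract _ _ _]/(xi j (lact _ (w i))).
  by rewrite xi_lactE (linear_sumE (hact_linear _ _)).
rewrite (right_expansion x) (linear_sumE (rhom_linear f)) (linear_sumE (rhom_linear _)).
by apply: eq_bigr => i _; rewrite !rhomM eqw.
Qed.

Lemma hom_connection_unique (nabla nabla' : hom_connection Om) :
  (forall i, nabla (xi i) = 0) -> (forall i, nabla' (xi i) = 0) ->
  forall f, nabla' f = nabla f.
Proof.
move=> n0 n0' f; have [a ->] := rhom_generated f; rewrite !linear_sum.
by apply: eq_bigr => j _; rewrite !hconn_leibniz n0 n0' !mul0r.
Qed.

Lemma covariant_hom_connection_xi i : covariant_hom_connection (xi i) = 0.
Proof.
rewrite -[LHS]/(nabla_sum (xi i)) /nabla_sum big1 // => j _; rewrite hxi.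
case: (i == j); last exact: (linear0 (mk_linear (hact_linear H (shift (tangent j))))).
have t10 : shift (tangent j) 1 = 0.
  by rewrite !compE !(Sinv1 SK) (twisted_derivation1 twist1 tangentM).
transitivity ((shift (tangent j) 1 : k) *: (1 : A)); first exact: hact1.
by rewrite t10 scale0r.
Qed.

Lemma right_integral_hact (l g : {linear A -> k^o}) a :
  right_integral H l -> l (hact H g a) = l a * g 1.
Proof.
move=> li; rewrite hactE linear_sum.
transitivity (g (l a *: 1)); last by rewrite linearZ.
rewrite -li (tlift_sw H a (bilinear_evall l)) linear_sum.
by apply: eq_bigr => p _; rewrite !linearZ /=; apply: mulrC.
Qed.

End CovariantCalculus.

(** * Functionals on the cokernel *)

Lemma coker_factor (k : fieldType) (U V : lmodType k) (f : {linear U -> V})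
    (l : {linear V -> k^o}) :
  (forall u, l (f u) = 0) ->
  exists phi : {linear coker f -> k^o},
    (forall a, l a = phi (coker_map f a)) /\
    (forall psi : {linear coker f -> k^o},
       (forall a, l a = psi (coker_map f a)) -> forall x, psi x = phi x).
Proof.
move=> lf; pose phi (x : coker f) : k^o :=
  l (repr (x : Quotient.quot (submod_pred (image_pred f)))).
have phiE a : phi (coker_map f a) = l a.
  apply/eqP; rewrite -subr_eq0 -linearB; apply/eqP.
  have /quot_piP/asboolP[u <-] := quot_reprK (coker_map f a); exact: lf.
have phi_lin : linear phi.
  move=> c x y; rewrite -(quot_reprK x) -(quot_reprK y).
  by rewrite -[quot_pi _]/(coker_map f : V -> coker f) -linearP !phiE linearP.
exists (mk_linear phi_lin); split=> [a|psi psiE x]; first by rewrite /= phiE.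
by rewrite -(quot_reprK x) -[quot_pi _]/(coker_map f : V -> coker f) -psiE /= phiE.
Qed.

Theorem theorem4p1 (k : fieldType) (A : algType k) (H : hopf_algebra A)
    (Sinv : A -> A)
    (SK : cancel (antipode H) Sinv) (SinvK : cancel Sinv (antipode H))
    (Om : fodc A)
    (DL : {linear Om -> tensor A Om}) (hDL : left_coaction H DL)
    (n : nat) (w : 'I_n -> Om) (hw : left_invariant_basis DL w)
    (xi : 'I_n -> rhom Om) (hxi : forall i j, xi i (w j) = (i == j)%:R)
    (lam : 'I_n -> Om -> A) (hlam : forall i, left_mod_map (lam i))
    (hlamw : forall i j, lam i (w j) = (i == j)%:R) :
  let S := antipode H in
  let chi (i : 'I_n) : A -> k := fun a => counit H (lam i (fodc_d Om a)) in
  exists nabla : hom_connection Om,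
    [/\ forall f : rhom Om,
          nabla f = \sum_i S (S (lam i (fodc_d Om (Sinv (Sinv (f (w i))))))),
        forall f : rhom Om,
          nabla f = \sum_i hact H (fun a => chi i (Sinv (Sinv a))) (f (w i)),
        (forall i, nabla (xi i) = 0),
        (forall nabla' : hom_connection Om,
          (forall i, nabla' (xi i) = 0) -> forall f, nabla' f = nabla f)
      & forall (E : dga_extension Om) (l : {linear A -> k^o}),
          flat E nabla -> right_integral H l ->
          exists phi : {linear coker nabla -> k^o},
            (forall a, l a = phi (coker_map nabla a)) /\
            (forall psi : {linear coker nabla -> k^o},
              (forall a, l a = psi (coker_map nabla a)) ->
              forall x, psi x = phi x)].
Proof.
pose T : {linear A -> A} := mk_linear (can2_linear SK SinvK).
have TK : cancel (antipode H) T := SK.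
have KT : cancel T (antipode H) := SinvK.
move=> S chi.
have n0 := covariant_hom_connection_xi hDL hw hxi hlam hlamw TK KT.
pose nabla := covariant_hom_connection hDL hw hxi hlam hlamw TK KT.
exists nabla; split=> //.
- move=> f; apply: eq_bigr => i _.
  rewrite -(antipode2_hact TK KT (tangent H hlam i)) /=.
  by rewrite -(lam_d hDL hw hlam hlamw).
- move=> nabla' n0'.
  exact: (hom_connection_unique hDL hw hxi hlam hlamw TK KT n0 n0').
- move=> E l _ li; apply: coker_factor => f.
  rewrite -[nabla f]/(nabla_sum H w hlam T f) /nabla_sum linear_sum big1 // => i _.
  have t1 : tangent H hlam i (T (T 1)) = 0.
    rewrite !(Sinv1 TK).
    exact: (twisted_derivation1 (twist1 H hlam hlamw) (tangentM H hw hlam hlamw)).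
  transitivity (l (f (w i)) * tangent H hlam i (T (T 1)) : k).
    exact: (right_integral_hact (tangent H hlam i \o (T \o T)) (f (w i)) li).
  by rewrite t1 mulr0.
Qed.
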